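(* Suppose $X$ is a real Banach space such that $X^{**}$ has the $L^1$-property. Let $Y$ be an arbitrary real Banach space and $Z$ a closed subspace of $Y$. Let $T\in\mathcal{K}(X,Y)$ be a multi-smooth operator of finite order. Suppose that $T\perp_B\mathcal{L}(X,Z)$. Then the following hold. (i) $d(T,\mathcal{L}(X,Z))=\sup_{x\in S_X}d(Tx,Z)$. (ii) $T^{**}x_0^{**}\perp_B Z^{\perp\perp}$ for some $x_0^{**}\in M_{T^{**}}\cap E_{X^{**}}$. (iii) $T^{**}\perp_B\mathcal{L}(X^{**},Z^{\perp\perp})$. (iv) There exists $x_0^{**}\in M_{T^{**}}\cap E_{X^{**}}$ such that $$d(T^{**},\mathcal{L}(X^{**},Z^{\perp\perp}))=\sup_{x^{**}\in S_{X^{**}}}d(T^{**}x^{**},Z^{\perp\perp})=d(T^{**}x_0^{**},Z^{\perp\perp})=d(T,\mathcal{L}(X,Z)).$$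
   Context: All Banach spaces are real. $\mathcal{L}(X,Y)$ (respectively $\mathcal{K}(X,Y)$) is the space of bounded (respectively compact) linear operators with the operator norm; for a subspace $Z\subset Y$, $\mathcal{L}(X,Z)$ is regarded as a subspace of $\mathcal{L}(X,Y)$. $S_X$, $B_X$ are the unit sphere and closed unit ball of $X$; $E_X$ is the set of extreme points of $B_X$. For an operator $T$ on $X$, $M_T=\{x\in S_X:\|Tx\|=\|T\|\}$. For a subspace $W$ of a normed space $V$ and $v\in V$, $d(v,W)=\inf_{w\in W}\|v-w\|$. Birkhoff-James orthogonality: $v\perp_B w$ means $\|v+\lambda w\|\ge\|v\|$ for all scalars $\lambda$; $v\perp_B W$ means $v\perp_B w$ for all $w\in W$. $Z^\perp=\{y^*\in Y^*:y^*(z)=0\ \forall z\in Z\}$ and $Z^{\perp\perp}\subset Y^{**}$ is the annihilator of $Z^\perp$; $T^{**}:X^{**}\to Y^{**}$ is the second adjoint, and $\mathcal{L}(X^{**},Z^{\perp\perp})$ is regarded as a subspace of $\mathcal{L}(X^{**},Y^{**})$. A non-zero $T\in\mathcal{L}(X,Y)$ is a multi-smooth operator of finite order if the linear span of $J(T)=\{f\in S_{\mathcal{L}(X,Y)^*}:f(T)=\|T\|\}$ is finite-dimensional. A Banach space $V$ has the $L^1$-property if for any $\{v_1,\dots,v_n\}\subseteq E_V$ with $v_i\neq\pm v_j$ for $1\le i\neq j\le n$, the set $\{v_1,\dots,v_n\}$ is linearly independent. *)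

(* Defs.v *)
From HB Require Import structures.
From mathcomp Require Import all_boot all_order all_algebra.
From mathcomp Require Import all_classical all_reals all_analysis.

Set Implicit Arguments.
Unset Strict Implicit.
Unset Printing Implicit Defensive.

Import Order.TTheory GRing.Theory Num.Theory.
Import numFieldNormedType.Exports.

Local Open Scope classical_set_scope.
Local Open Scope ring_scope.

Section NormedSpaceNotions.
Context {R : realType} {V : normedModType R}.
Implicit Types (A W : set V) (v w x y z : V).

Definition unit_sphere : set V := [set x | `|x| = 1].

Definition unit_ball : set V := [set x | `|x| <= 1].

Definition extreme_points A : set V :=
  [set x | A x /\ forall y z (t : R), A y -> A z -> 0 < t < 1 ->
     x = t *: y + (1 - t) *: z -> y = x /\ z = x].

Definition dist v W : R := inf [set `|v - w| | w in W].

Definition BJ_orthogonal v w : Prop := forall l : R, `|v| <= `|v + l *: w|.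

Definition BJ_orthogonal_set v W : Prop := forall w, W w -> BJ_orthogonal v w.

Definition linearly_independent (n : nat) (v : 'I_n -> V) : Prop :=
  forall a : 'I_n -> R, \sum_(i < n) a i *: v i = 0 -> forall i, a i = 0.

Definition linear_span A : set V :=
  [set x | exists n (a : 'I_n -> R) (v : 'I_n -> V),
     (forall i, A (v i)) /\ x = \sum_(i < n) a i *: v i].

Definition finite_dimensional W : Prop :=
  exists2 B : set V, finite_set B & W = linear_span B.

Definition linear_subspace W : Prop := submod_closed [pred x | x \in W].

End NormedSpaceNotions.

Arguments unit_sphere {R} V.
Arguments unit_ball {R} V.

Definition L1_property {R : realType} (V : normedModType R) : Prop :=
  forall (n : nat) (v : 'I_n -> V),
    (forall i, extreme_points (unit_ball V) (v i)) ->
    (forall i j, i != j -> v i <> v j /\ v i <> - v j) ->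
    linearly_independent v.

Section BoundedOperators.
Context {R : realType} (V W : normedModType R).

Definition bounded_linear : {pred V -> W} :=
  [pred f | `[< linear f /\ bounded_fun_norm f >]].

Lemma bounded_linear_submod_closed : submod_closed bounded_linear.
Proof.
split=> [|a f g]; rewrite !inE.
  split; first by move=> a x y; rewrite /= scaler0 addr0.
  by move=> r; exists 0 => x _; rewrite normr0.
move=> [lf bf] [lg bg]; split.
  move=> b x y; rewrite !fctE lf lg !scalerDr !scalerA [a * b]mulrC.
  by rewrite addrACA.
move=> r; have [M fM] := bf r; have [N gN] := bg r.
exists (`|a| * M + N) => x xr.
by rewrite (le_trans (ler_normD _ _))// lerD ?gN// normrZ ler_wpM2l ?fM.
Qed.

HB.instance Definition _ := GRing.isSubmodClosed.Build R (V -> W)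
  bounded_linear bounded_linear_submod_closed.

Record bop := Bop { bop_fun :> V -> W ; _ : bop_fun \in bounded_linear }.

HB.instance Definition _ := [isSub for bop_fun].
HB.instance Definition _ := [Choice of bop by <:].
HB.instance Definition _ := [SubChoice_isSubLmodule of bop by <:].

Implicit Types f g : bop.

Lemma bop_linear f : linear f.
Proof. by case: f => f /=; rewrite inE => -[]. Qed.

Lemma bop_bounded f : bounded_fun_norm f.
Proof. by case: f => f /=; rewrite inE => -[]. Qed.

HB.instance Definition _ f := GRing.isLinear.Build R V W _ f (bop_linear f).

Lemma bopP f g : f =1 g -> f = g.
Proof. by move=> fg; apply/val_inj/funext. Qed.

Lemma bopDE f g x : (f + g) x = f x + g x. Proof. by []. Qed.

Lemma bopNE f x : (- f) x = - f x. Proof. by []. Qed.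

Lemma bopZE (a : R) f x : (a *: f) x = a *: f x. Proof. by []. Qed.

Lemma bop0E x : (0 : bop) x = 0. Proof. by []. Qed.

(* Over the closed ball rather than the sphere, so that no case distinction is
   needed when V is the zero space. *)
Definition opnorm f : R := sup [set `|f x| | x in unit_ball V].

Lemma opnorm_has_sup f : has_sup [set `|f x| | x in unit_ball V].
Proof.
split; first by exists `|f 0|, 0 => //=; rewrite /unit_ball/= normr0.
by have [M fM] := bop_bounded f 1; exists M => _ [x /fM xM <-].
Qed.

Lemma opnorm_unit_ball f x : unit_ball V x -> `|f x| <= opnorm f.
Proof. by move=> x1; apply: sup_ubound; [case: (opnorm_has_sup f)|exists x]. Qed.

Lemma opnorm_le f (M : R) :
  (forall x, unit_ball V x -> `|f x| <= M) -> opnorm f <= M.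
Proof.
move=> fM; apply: ge_sup; first by case: (opnorm_has_sup f).
by move=> _ [x x1 <-]; exact: fM.
Qed.

Lemma opnorm_ge0 f : 0 <= opnorm f.
Proof.
by apply: le_trans (@opnorm_unit_ball f 0 _); rewrite // /unit_ball/= normr0.
Qed.

Lemma le_opnorm f x : `|f x| <= opnorm f * `|x|.
Proof.
have [->|x0] := eqVneq x 0; first by rewrite linear0 !normr0 mulr0.
have nx : 0 < `|x| by rewrite normr_gt0.
rewrite -ler_pdivrMr// mulrC -[`|x|^-1]ger0_norm ?invr_ge0// -normrZ -linearZ.
apply: opnorm_unit_ball.
by rewrite /unit_ball/= normrZ ger0_norm ?invr_ge0// mulVf// gt_eqF.
Qed.

Let opnormD f g : opnorm (f + g) <= opnorm f + opnorm g.
Proof.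
apply: opnorm_le => x x1; rewrite bopDE (le_trans (ler_normD _ _))//.
by rewrite lerD ?opnorm_unit_ball.
Qed.

Let opnormZ (a : R) f : opnorm (a *: f) = `|a| * opnorm f.
Proof.
have le (b : R) g : opnorm (b *: g) <= `|b| * opnorm g.
  apply: opnorm_le => x x1; rewrite bopZE normrZ.
  by rewrite ler_wpM2l ?opnorm_unit_ball.
apply/eqP; rewrite eq_le le/=.
have [->|a0] := eqVneq a 0; first by rewrite normr0 mul0r opnorm_ge0.
rewrite -ler_pdivlMl ?normr_gt0// -normfV.
by rewrite (le_trans _ (le _ _))// scalerA mulVf// scale1r.
Qed.

Let opnorm0_eq0 f : opnorm f = 0 -> f = 0.
Proof.
move=> f0; apply: bopP => x; apply/eqP; rewrite -normr_le0.
by rewrite (le_trans (le_opnorm f x))// f0 mul0r.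
Qed.

HB.instance Definition _ :=
  Lmodule_isNormed.Build R bop opnormD opnormZ opnorm0_eq0.

Lemma bop_normE f : `|f| = sup [set `|f x| | x in unit_ball V].
Proof. by []. Qed.

Lemma bop_norm_le f x : `|f x| <= `|f| * `|x|.
Proof. exact: le_opnorm. Qed.

End BoundedOperators.

Arguments bounded_linear {R} V W _.

Section OperatorSets.
Context {R : realType} {V W : normedModType R}.

Definition compact_operator (f : bop V W) : Prop := precompact (f @` unit_ball V).

(* The space L(V, Z), seen as a set of operators from V to W. *)
Definition ops_into (Z : set W) : set (bop V W) :=
  [set A : bop V W | forall x, Z (A x)].

Definition norm_attainment (f : bop V W) : set V :=
  [set x | unit_sphere V x /\ `|f x| = `|f|].

End OperatorSets.

Arguments ops_into {R} V {W} Z.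

Definition dual {R : realType} (V : normedModType R) : normedModType R :=
  bop V R^o.

Notation bidual V := (dual (dual V)).

Section Adjoint.
Context {R : realType} (V W : normedModType R).

Lemma comp_bounded_linear (U : normedModType R) (g : bop W U) (f : bop V W) :
  g \o f \in bounded_linear V U.
Proof.
rewrite inE; split; first by move=> a x y /=; rewrite !linearP.
move=> r; exists (`|g| * (`|f| * r)) => x xr /=.
rewrite (le_trans (bop_norm_le _ _))// ler_wpM2l//.
by rewrite (le_trans (bop_norm_le _ _))// ler_wpM2l.
Qed.

Definition bop_comp (U : normedModType R) (g : bop W U) (f : bop V W) : bop V U :=
  Bop (comp_bounded_linear g f).

Lemma adjoint_bounded_linear (T : bop V W) :
  (fun g : dual W => bop_comp g T : dual V) \in bounded_linear (dual W) (dual V).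
Proof.
rewrite inE; split; first by move=> a g h; exact: bopP.
move=> r; exists (r * `|T|) => g gr; apply: opnorm_le => x x1 /=.
rewrite (le_trans (bop_norm_le _ _))// ler_pM//.
exact: (opnorm_unit_ball T).
Qed.

Definition adjoint (T : bop V W) : bop (dual W) (dual V) :=
  Bop (adjoint_bounded_linear T).

Definition annihilator (Z : set V) : set (dual V) :=
  [set f : dual V | forall z, Z z -> f z = 0].

Definition support_functionals (v : V) : set (dual V) :=
  [set f : dual V | unit_sphere (dual V) f /\ f v = `|v|].

(* Stated for a vector of a normed space; an operator T is an element of the
   normed space bop X Y, so that support_functionals T is J(T). *)
Definition multi_smooth_finite_order (v : V) : Prop :=
  v <> 0 /\ finite_dimensional (linear_span (support_functionals v)).

End Adjoint.

(* Main.v *)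
Require Import Defs.
From HB Require Import structures.
From mathcomp Require Import all_boot all_order all_algebra.
From mathcomp Require Import all_classical all_reals all_analysis.
From mathcomp Require Import ring lra.

Set Implicit Arguments.
Unset Strict Implicit.
Unset Printing Implicit Defensive.

Import Order.TTheory GRing.Theory Num.Theory.
Import numFieldNormedType.Exports.

Local Open Scope classical_set_scope.
Local Open Scope ring_scope.

(** Everything follows from one extreme point u of the unit ball of X^** for
    which u (T^* y) comes arbitrarily close to |T|, with y in the unit ball of
    Z^perp: such y vanish on Z and on its bi-annihilator, so they bound all the
    distances of the theorem from below by |T|, while orthogonality and the
    choice of 0 as approximant bound them from above (lemma
    [extreme_near_annihilator] gives u).

    To find u, consider the pairs (u, y) in the unit balls of X^** and Y^* with
    u (T^* y) = |T|.  Each gives the support functional A |-> u (A^* y) of T,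
    and linearly independent u's give linearly independent functionals, as one
    sees on rank-one operators.  Multi-smoothness therefore bounds the size of
    independent families of such u's ([attaining_bound]).  By the L^1-property,
    extreme u's that are pairwise neither equal nor opposite are independent, so
    up to sign there are only finitely many of them, x_1, ..., x_n
    ([extreme_attaining_finite]).

    Suppose none of the x_i has the desired property.  Since T is compact,
    T^** x_i lies in Y up to arbitrarily small errors ([biadjoint_approx]), and
    the duality formula for distances gives z_i in Z with
    |T^** x_i - z_i| < |T| ([biadjoint_near_subspace]).  Choose g_i in X^* dual
    to the x_i and let A be the sum of the rank-one operators g_i (.) z_i, an
    operator into Z with A^** x_i = z_i.  As T is orthogonal to A, a limit of
    pairs almost norming T - e A as e tends to 0 is a norming pair (u, y) of T
    with u (A^* y) <= 0 ([orthogonal_limit_pair]).  The u's norming T together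
    with y form a face of the ball of X^**, and this face is separated by
    finitely many elements of X^*, so it has an extreme point v with
    v (A^* y) <= u (A^* y) <= 0 ([exposed_face_extreme]).  But v = s x_i with
    s = 1 or s = -1, whence v (A^* y) = s y (z_i), which differs from
    s x_i (T^* y) = |T| by less than |T| and is positive: a contradiction.

    Weak-star compactness is used through pointwise limits along ultrafilters,
    and the functionals needed come from the Mazur-Orlicz theorem. *)

(** * The theorems of Hahn-Banach and Mazur-Orlicz *)

Section HahnBanach.
Context {R : realType} {V : lmodType R}.
Implicit Types (p q : V -> R) (C : set (V * R)) (x y : V).

(** Homogeneity is only asked as an inequality, which passes to infima without
    effort; equality follows by scaling back. *)
Definition sublinear p : Prop :=
  (forall x y, p (x + y) <= p x + p y) /\
  (forall t x, 0 < t -> p (t *: x) <= t * p x).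

Lemma sublinear0 p : sublinear p -> p 0 = 0.
Proof.
case=> _ ph.
have := ph 2 0 (ltr0n _ 2); have := ph 2^-1 0; rewrite !scaler0 invr_gt0.
by move=> /(_ (ltr0n _ 2)); lra.
Qed.

Lemma sublinear_opp_le p x y : sublinear p -> - p (- x) <= p (x + y) - p y.
Proof.
case=> pD _; have := pD (- x) (x + y); rewrite addKr; lra.
Qed.

(** A pair (c, a) in the cone stands for the constraint a <= g c on a linear
    functional g <= p. *)
Definition minorant_cone p C : Prop :=
  [/\ C (0, 0),
      (forall c d, C c -> C d -> C (c.1 + d.1, c.2 + d.2)),
      (forall t c, 0 < t -> C c -> C (t *: c.1, t * c.2)) &
      (forall c, C c -> c.2 <= p c.1)].

(** The largest candidate value at x for a functional g <= p that satisfies the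
    constraints: g x = g (x + c) - g c <= p (x + c) - a. *)
Definition cone_inf p C x : R := inf [set p (x + c.1) - c.2 | c in C].

Lemma cone_inf_le p C x c : sublinear p -> minorant_cone p C -> C c ->
  cone_inf p C x <= p (x + c.1) - c.2.
Proof.
move=> ps [_ _ _ Cp] Cc; apply: ge_inf; last by exists c.
exists (- p (- x)) => _ [d Cd <-].
have := sublinear_opp_le x d.1 ps; have := Cp _ Cd; lra.
Qed.

Lemma le_cone_inf p C x (a : R) : C !=set0 ->
  (forall c, C c -> a <= p (x + c.1) - c.2) -> a <= cone_inf p C x.
Proof.
by move=> [c Cc] aC; apply: lb_le_inf => [|_ [d /aC ? <-]//]; exists (p (x + c.1) - c.2), c.
Qed.

Lemma cone_inf_sublinear p C : sublinear p -> minorant_cone p C ->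
  sublinear (cone_inf p C) /\ forall x, cone_inf p C x <= p x.
Proof.
move=> ps Cm; have [C0 CD CZ _] := Cm; have [pD ph] := ps.
have C_neq0 : C !=set0 by exists (0, 0).
split; last first.
  by move=> x; have := cone_inf_le x ps Cm C0; rewrite /= addr0 subr0.
split=> [x y|t x t0].
  rewrite -lerBlDr; apply: le_cone_inf => // c Cc.
  rewrite lerBlDr -lerBlDl; apply: le_cone_inf => // d Cd.
  rewrite lerBlDl; apply: le_trans (cone_inf_le _ ps Cm (CD _ _ Cc Cd)) _ => /=.
  by have := pD (x + c.1) (y + d.1); rewrite addrACA; lra.
rewrite -ler_pdivrMl//; apply: le_cone_inf => // c Cc.
rewrite ler_pdivrMl//; apply: le_trans (cone_inf_le _ ps Cm (CZ _ _ t0 Cc)) _ => /=.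
by rewrite -scalerDr mulrBr lerB// ph.
Qed.

(** Imposing the constraint p y <= g y through the half-line spanned by y gives
    a smaller sublinear functional, which minimality forces to be p itself;
    this reads p x + p y <= p (x + y). *)
Lemma minimal_sublinear_linear p : sublinear p ->
  (forall q, sublinear q -> (forall x, q x <= p x) -> q = p) -> linear (p : V -> R^o).
Proof.
move=> ps pmin.
have p0 := sublinear0 ps; have [pD ph] := ps.
have pDE x y : p (x + y) = p x + p y.
  apply/eqP; rewrite eq_le pD/=.
  pose C : set (V * R) := [set c | exists2 t, 0 <= t & c = (t *: y, t * p y)].
  have Cm : minorant_cone p C.
    split=> [|_ _ [t t0 ->] [s s0 ->]|t _ t0 [s s0 ->]|_ [t t0 ->]] /=.
    - by exists 0; rewrite ?scale0r ?mul0r.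
    - by exists (t + s); rewrite ?addr_ge0// scalerDl mulrDl.
    - by exists (t * s); [exact: mulr_ge0 (ltW t0) s0|rewrite scalerA mulrA].
    - move: t0; rewrite le_eqVlt => /predU1P[<-|t0].
        by rewrite scale0r mul0r p0.
      have := ph t^-1 (t *: y); rewrite invr_gt0 => /(_ t0).
      by rewrite scalerA mulVf ?gt_eqF// scale1r ler_pdivlMl.
  have [qs qp] := cone_inf_sublinear ps Cm.
  rewrite -(pmin _ qs qp) -lerBrDr (pmin _ qs qp) -{1}(pmin _ qs qp).
  have /(cone_inf_le x ps Cm) : C (y, p y) by exists 1; rewrite ?ler01 ?scale1r ?mul1r.
  by [].
have pN x : p (- x) = - p x.
  by have := pDE (- x) x; rewrite addNr p0 => /esym/eqP; rewrite addr_eq0 => /eqP.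
have pZ t x : 0 < t -> p (t *: x) = t * p x.
  move=> t0; apply/eqP; rewrite eq_le ph//=.
  by have := ph t (- x) t0; rewrite scalerN !pN mulrN lerN2.
move=> t x y; rewrite pDE; congr (_ + _); rewrite [RHS]/GRing.scale/=.
have [t0|t0|->] := ltgtP t 0; last by rewrite scale0r mul0r p0.
  by have := pZ (- t) x; rewrite oppr_gt0 scaleNr pN mulNr => /(_ t0)/oppr_inj.
exact: pZ.
Qed.

Lemma chain_inf_sublinear p (A : set (V -> R)) : A !=set0 ->
  (forall q, A q -> sublinear q /\ forall x, q x <= p x) ->
  (forall q r, A q -> A r -> (forall x, q x <= r x) \/ (forall x, r x <= q x)) ->
  exists m, [/\ sublinear m, (forall x, m x <= p x) &
    forall q x, A q -> m x <= q x].
Proof.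
move=> [q0 Aq0] Asp Atot.
pose m x := inf [set q x | q in A].
have mle q x : A q -> m x <= q x.
  move=> Aq; apply: ge_inf; last by exists q.
  exists (- p (- x)) => _ [r Ar <-]; have [rs rp] := Asp _ Ar.
  by have := sublinear_opp_le x 0 rs; rewrite addr0 sublinear0//; have := rp (- x); lra.
have lem x a : (forall q, A q -> a <= q x) -> a <= m x.
  by move=> aA; apply: lb_le_inf => [|_ [q /aA ? <-]//]; exists (q0 x), q0.
exists m; split=> //; last by move=> x; apply: le_trans (mle _ _ Aq0) _; apply: (Asp _ Aq0).2.
split=> [x y|t x t0].
  rewrite -lerBlDr; apply: (lem x) => // q Aq.
  rewrite lerBlDr -lerBlDl; apply: (lem y) => // r Ar.
  rewrite lerBlDl; have [qr|rq] := Atot _ _ Aq Ar.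
    apply: le_trans (mle _ _ Aq) _; apply: le_trans ((Asp _ Aq).1.1 x y) _.
    by rewrite lerD2l.
  apply: le_trans (mle _ _ Ar) _; apply: le_trans ((Asp _ Ar).1.1 x y) _.
  by rewrite lerD2r.
rewrite -ler_pdivrMl//; apply: (lem x) => // q Aq; rewrite ler_pdivrMl//.
by apply: le_trans (mle _ _ Aq) _; apply: (Asp _ Aq).1.2.
Qed.

(** Zorn's lemma produces a minimal sublinear functional below p. *)
Lemma hahn_banach_sublinear p : sublinear p ->
  exists2 g : V -> R, linear (g : V -> R^o) & forall x, g x <= p x.
Proof.
move=> ps; pose S := {q : V -> R | sublinear q /\ forall x, q x <= p x}.
have [|||A Atot|[q [qs qp]] qmin] := @Zorn S (fun q r : S => `[< forall x : V, sval r x <= sval q x >]).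
- by move=> q; apply/asboolP.
- move=> q r s /asboolP rq /asboolP sr; apply/asboolP => x.
  exact: le_trans (sr x) (rq x).
- move=> [q qs] [r rs] /asboolP/= rq /asboolP/= qr.
  by apply: eq_exist; apply/funext => x; apply/eqP; rewrite eq_le rq qr.
- have [[q0 Aq0]|A0] := pselect (A !=set0); last first.
    by exists (exist _ p (conj ps (fun=> lexx _)) : S) => s As; case: A0; exists s.
  have [|||m [ms mp mA]] := @chain_inf_sublinear p [set sval q | q in A].
  + by exists (sval q0), q0.
  + by move=> _ [q _ <-]; case: (svalP q).
  + by move=> _ _ [q Aq <-] [r Ar <-]; have [/asboolP|/asboolP] := Atot _ _ Aq Ar; [right|left].
  exists (exist _ m (conj ms mp) : S) => s As; apply/asboolP => x /=.
  by apply: mA; exists s.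
exists q => //; apply: minimal_sublinear_linear => // r rs rq.
have rp x : r x <= p x by exact: le_trans (rq x) (qp x).
by have /(congr1 sval) := qmin (exist _ r (conj rs rp) : S) (asboolT rq).
Qed.

(** Any linear functional below cone_inf p C satisfies the constraints: its
    value at - c is at most p 0 - a = - a. *)
Theorem mazur_orlicz p C : sublinear p -> minorant_cone p C ->
  exists g : V -> R, [/\ linear (g : V -> R^o), forall x, g x <= p x &
    forall c, C c -> c.2 <= g c.1].
Proof.
move=> ps Cm; have [qs qp] := cone_inf_sublinear ps Cm.
have [g lg gq] := hahn_banach_sublinear qs.
exists g; split=> // [x|c Cc]; first exact: le_trans (gq x) (qp x).
have := le_trans (gq (- c.1)) (cone_inf_le _ ps Cm Cc).
rewrite addNr sublinear0// sub0r.
have -> : g (- c.1) = - g c.1; last by rewrite lerN2.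
have := lg (-1) c.1 0; rewrite addr0 scaleN1r => ->.
have := lg (-1) 0 0; rewrite scaler0 addr0 scaleN1r => g0.
rewrite scaleN1r; have -> : g 0 = 0; last by rewrite addr0.
by move: g0; rewrite addNr.
Qed.

End HahnBanach.

(** * Norm-preserving functionals and distances to subspaces *)

Section NormedDuality.
Context {R : realType}.
Implicit Types V : normedModType R.

Lemma functional_of_bound V (g : V -> R) (M : R) : 0 <= M ->
  linear (g : V -> R^o) -> (forall x, g x <= M * `|x|) ->
  exists2 f : dual V, f =1 g & `|f| <= M.
Proof.
move=> M0 gl gM.
have g0 : g 0 = 0.
  by have := gl (-1) 0 0; rewrite scaler0 addr0 scaleN1r addNr.
have gN x : g (- x) = - g x.
  by have := gl (-1) x 0; rewrite !addr0 g0 !scaleN1r addr0.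
have gM' x : `|g x| <= M * `|x|.
  by rewrite ler_norml gM andbT lerNl -gN (le_trans (gM _))// normrN.
have gB : (g : V -> R^o) \in bounded_linear V R^o.
  rewrite inE; split=> // r; exists (M * r) => x xr.
  by rewrite (le_trans (gM' x))// ler_wpM2l.
exists (Bop gB) => //; apply: opnorm_le => x x1 /=.
by rewrite (le_trans (gM' x))// -[leRHS]mulr1 ler_wpM2l.
Qed.

Lemma dual_addE V (f g : dual V) v : (f + g) v = f v + g v :> R.
Proof. by []. Qed.

Lemma dual_oppE V (f : dual V) v : (- f) v = - f v :> R.
Proof. by []. Qed.

Lemma dual_scaleE V (a : R) (f : dual V) v : (a *: f) v = a * f v :> R.
Proof. by []. Qed.

Lemma dual_sumE V (I : Type) (r : seq I) (P : pred I) (F : I -> dual V) v :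
  (\sum_(i <- r | P i) F i) v = \sum_(i <- r | P i) F i v :> R.
Proof. by apply: (big_morph (fun f : dual V => f v : R)). Qed.

Lemma dual0 V (f : dual V) : f 0 = 0 :> R.
Proof. exact: linear0. Qed.

Lemma dualD V (f : dual V) v w : f (v + w) = f v + f w :> R.
Proof. exact: linearD. Qed.

Lemma dualN V (f : dual V) v : f (- v) = - f v :> R.
Proof. exact: linearN. Qed.

Lemma dualB V (f : dual V) v w : f (v - w) = f v - f w :> R.
Proof. exact: linearB. Qed.

Lemma dualZ V (f : dual V) (a : R) v : f (a *: v) = a * f v :> R.
Proof. exact: linearZ. Qed.

Lemma dual_sum V (f : dual V) (I : Type) (r : seq I) (P : pred I) (F : I -> V) :
  f (\sum_(i <- r | P i) F i) = \sum_(i <- r | P i) f (F i) :> R.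
Proof. exact: linear_sum. Qed.

Lemma dual_le V (f : dual V) v : f v <= `|f| * `|v|.
Proof. exact: le_trans (ler_norm _) (bop_norm_le f v). Qed.

Lemma dual_ball_le V (f : dual V) v : `|f| <= 1 -> f v <= `|v|.
Proof.
by move=> f1; rewrite (le_trans (dual_le f v))// -[leRHS]mul1r ler_wpM2r.
Qed.

Lemma norm_sublinear V (M : R) : 0 <= M -> sublinear (fun v : V => M * `|v|).
Proof.
move=> M0; split=> [x y|t x t0]; first by rewrite -mulrDr ler_wpM2l ?ler_normD.
by rewrite normrZ gtr0_norm// mulrCA.
Qed.

Lemma ge_dist V (v w : V) (W : set V) : W w -> dist v W <= `|v - w|.
Proof.
by move=> Ww; apply: ge_inf; [exists 0 => _ [? _ <-]|exists w].
Qed.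

Lemma le_dist V (v : V) (W : set V) (a : R) : W !=set0 ->
  (forall w, W w -> a <= `|v - w|) -> a <= dist v W.
Proof.
by move=> [w Ww] aW; apply: lb_le_inf => [|_ [u /aW ? <-]//]; exists `|v - w|, w.
Qed.

Lemma dist_ge0 V (v : V) (W : set V) : 0 <= dist v W.
Proof.
have [W0|W0] := pselect (W !=set0); first by apply: le_dist.
rewrite /dist inf_out// => -[[_ [w Ww _]] _]; by apply: W0; exists w.
Qed.

Lemma linear_subspaceP V (W : set V) : linear_subspace W <->
  W 0 /\ forall a u v, W u -> W v -> W (a *: u + v).
Proof.
split=> [[W0 WD]|[W0 WD]].
  split; first by move: W0; rewrite !inE.
  by move=> a u v /mem_set Wu /mem_set Wv; apply/set_mem; apply: WD.
split; first by rewrite !inE.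
move=> a u v; rewrite !inE => Wu Wv; exact: WD.
Qed.

Lemma subspace0 V (W : set V) : linear_subspace W -> W 0.
Proof. by move/linear_subspaceP => []. Qed.

Lemma subspaceD V (W : set V) u v : linear_subspace W -> W u -> W v -> W (u + v).
Proof.
by move/linear_subspaceP => [_ /(_ 1 u v)]; rewrite scale1r.
Qed.

Lemma subspaceZ V (W : set V) a u : linear_subspace W -> W u -> W (a *: u).
Proof.
by move/linear_subspaceP => [W0 /(_ a u 0)]; rewrite addr0 => h /h; apply.
Qed.

(** Constraints: vanish on W (a subspace, so bounds from one side suffice) and
    be at least dist v W at v.  They are compatible with the norm because
    t * dist v W <= |t v - w| for t >= 0. *)
Lemma dist_functional V (W : set V) (v : V) : linear_subspace W ->
  exists f : dual V, [/\ `|f| <= 1, annihilator W f & f v = dist v W].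
Proof.
move=> Ws; have W0 := subspace0 Ws.
pose C : set (V * R) :=
  [set c | exists w t, [/\ W w, 0 <= t & c = (t *: v - w, t * dist v W)]].
have ps := @norm_sublinear V 1 ler01.
have Cm : minorant_cone (fun v : V => 1 * `|v|) C.
  split.
  - by exists 0, 0; rewrite scale0r subr0 mul0r.
  - move=> _ _ [w [t [Ww t0 ->]]] [u [s [Wu s0 ->]]].
    exists (w + u), (t + s); split; [exact: subspaceD|exact: addr_ge0|].
    by rewrite /= scalerDl mulrDl opprD addrACA.
  - move=> t _ t0 [w [s [Ww s0 ->]]].
    exists (t *: w), (t * s); split; [exact: subspaceZ|exact: mulr_ge0 (ltW t0) s0|].
    by rewrite /= scalerBr scalerA mulrA.
  - move=> _ [w [t [Ww t0 ->]]] /=; rewrite mul1r.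
    move: t0; rewrite le_eqVlt => /predU1P[<-|t0]; first by rewrite mul0r.
    rewrite -[t in leLHS]gtr0_norm// -ler_pdivlMl ?normr_gt0 ?gt_eqF//.
    rewrite -normfV -normrZ scalerBr scalerA mulVf ?gt_eqF// scale1r.
    by apply: ge_dist; exact: subspaceZ.
have [g [gl gle gC]] := mazur_orlicz ps Cm.
have [f fg f1] := functional_of_bound ler01 gl gle.
have fC c : C c -> c.2 <= f c.1 by rewrite fg; exact: gC.
have fW : annihilator W f.
  have fle w : W w -> f w <= 0.
    move=> Ww; have /fC/= : C (- w, 0).
      by exists w, 0; split=> //; rewrite scale0r sub0r mul0r.
    by rewrite linearN oppr_ge0.
  move=> w Ww; apply/eqP; rewrite eq_le fle//=.
  by have := fle (- w); rewrite linearN oppr_le0 -scaleN1r; apply; exact: subspaceZ.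
exists f; split=> //; apply/eqP; rewrite eq_le; apply/andP; split; last first.
  have /fC/= : C (v, dist v W) by exists 0, 1; rewrite scale1r subr0 mul1r.
  by [].
apply: le_dist; first by exists 0.
move=> w Ww; have := dual_ball_le (v - w) f1.
by rewrite linearB/= (fW w Ww) subr0.
Qed.

Lemma norming_functional V (v : V) : exists2 f : dual V, `|f| <= 1 & f v = `|v|.
Proof.
have s0 : linear_subspace [set (0 : V)].
  by apply/linear_subspaceP; split=> // a _ _ -> ->; rewrite scaler0 addr0.
have [f [f1 _ fv]] := dist_functional v s0.
by exists f; rewrite // fv /dist image_set1 inf1 subr0.
Qed.

(** The Hahn-Banach extension theorem, for a functional given as the
    restriction to W of one that is already defined everywhere but may have a
    larger norm there. *)
Lemma functional_extension V (W : set V) (f : dual V) (r : R) :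
  linear_subspace W -> 0 <= r -> (forall w, W w -> f w <= r * `|w|) ->
  exists2 g : dual V, `|g| <= r & forall w, W w -> g w = f w.
Proof.
move=> Ws r0 fr.
pose C : set (V * R) := [set c | W c.1 /\ c.2 = f c.1].
have Cm : minorant_cone (fun v : V => r * `|v|) C.
  split=> [|c d [Wc ->] [Wd ->]|t c t0 [Wc ->]|c [Wc ->]] /=.
  - by split=> /=; [exact: subspace0|rewrite linear0].
  - by split=> /=; [exact: subspaceD|rewrite linearD].
  - by split=> /=; [exact: subspaceZ|rewrite linearZ].
  - exact: fr.
have [g [gl gle gC]] := mazur_orlicz (@norm_sublinear V r r0) Cm.
have [h hg h1] := functional_of_bound r0 gl gle.
have hf w : W w -> f w <= h w by move=> Ww; rewrite hg; exact: (gC (w, f w)).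
exists h => // w Ww; apply/eqP; rewrite eq_le hf// andbT.
by have := hf (- w); rewrite !linearN lerN2 -scaleN1r; apply; exact: subspaceZ.
Qed.

Lemma annihilator_subspace V (W : set V) : linear_subspace (annihilator W).
Proof.
apply/linear_subspaceP; split=> [w _|a f g fW gW w Ww]; first by [].
by rewrite bopDE bopZE fW// gW// scaler0 addr0.
Qed.

Lemma evaluation_key V (v : V) : exists f : bidual V, forall g : dual V, f g = g v.
Proof.
have [|||f fE _] := @functional_of_bound (dual V) (fun g => g v) `|v|.
- exact: normr_ge0.
- by [].
- by move=> g; rewrite mulrC; exact: dual_le.
- by exists f.
Qed.

Definition evaluation V (v : V) : bidual V := sval (cid (evaluation_key v)).

Lemma evaluationE V (v : V) (g : dual V) : evaluation v g = g v.
Proof. by rewrite /evaluation; case: cid => f /= ->. Qed.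

End NormedDuality.

(** * Finite families of functionals *)

Section FiniteRankDuality.
Context {R : realType}.
Implicit Types V : normedModType R.

(** By induction: if u_0 does not already vanish where all the others do, pick
    v there with u_0 v <> 0 and subtract from f the multiple of u_0 that
    corrects the value at v. *)
Lemma kernel_lemma V n (u : 'I_n -> dual V) (f : dual V) :
  (forall v, (forall i, u i v = 0) -> f v = 0) ->
  exists a : 'I_n -> R, f = \sum_(i < n) a i *: u i.
Proof.
elim: n u f => [u f f0|n IH u f uf].
  by exists (fun=> 0); rewrite big_ord0; apply: bopP => v; rewrite f0// => -[].
have [[v [uv u0v]]|u0] := pselect (exists v,
    (forall i, u (lift ord0 i) v = 0) /\ u ord0 v <> 0); last first.
  have [|a fa] := IH (fun i => u (lift ord0 i)) f.
    move=> v uv; apply: uf => i.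
    have [j ->|->] := unliftP ord0 i; first exact: uv.
    by apply: contrapT => u0v; apply: u0; exists v.
  exists (fun i => oapp a 0 (unlift ord0 i)).
  rewrite big_ord_recl unlift_none scale0r add0r fa.
  by apply: eq_bigr => i _; rewrite liftK.
have [|a fa] := IH (fun i => u (lift ord0 i)) (f - (f v / u ord0 v) *: u ord0).
  move=> w uw; have : f (w - (u ord0 w / u ord0 v) *: v) = 0.
    apply: uf => i; rewrite dualB dualZ.
    have [j ->|->] := unliftP ord0 i; first by rewrite uw uv mulr0 subr0.
    by rewrite divfK ?subrr//; apply/eqP.
  rewrite dualB dualZ => /eqP; rewrite subr_eq0 => /eqP fw.
  rewrite dual_addE dual_oppE dual_scaleE fw; apply/eqP.
  by rewrite subr_eq0 mulrAC [eqbRHS]mulrAC [f v * _]mulrC.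
exists (fun i => oapp a (f v / u ord0 v) (unlift ord0 i)).
rewrite big_ord_recl unlift_none.
under eq_bigr do rewrite liftK/=.
by rewrite -fa addrC subrK.
Qed.

(** By the kernel lemma, u_j cannot vanish on the common kernel of the other
    functionals; a suitable vector of that kernel is e_j. *)
Lemma dual_basis V n (u : 'I_n -> dual V) : linearly_independent u ->
  exists e : 'I_n -> V, forall i j, u i (e j) = (i == j)%:R.
Proof.
move=> ui; have /choice[e eP] : forall j, exists v, forall i, u i v = (i == j)%:R.
  case: n u ui => [u _ []//|n u ui] j.
  have [v [uv ujv]] : exists v, (forall i, u (lift j i) v = 0) /\ u j v <> 0.
    apply: contrapT => nv.
    have [|a uja] := @kernel_lemma V n (fun i => u (lift j i)) (u j).
      by move=> v uv; apply: contrapT => ujv; apply: nv; exists v.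
    pose b i : R := oapp (fun k => - a k) 1 (unlift j i).
    have /ui/(_ j) : \sum_(i < n.+1) b i *: u i = 0.
      rewrite (bigD1_ord j)//= {1}/b unlift_none scale1r.
      under eq_bigr do rewrite /b liftK/= scaleNr.
      by rewrite sumrN -uja subrr.
    by rewrite /b unlift_none/= => /eqP; rewrite oner_eq0.
  exists ((u j v)^-1 *: v) => i; rewrite dualZ.
  have [k ->|->] := unliftP j i; last by rewrite eqxx mulVf//; exact/eqP.
  by rewrite uv mulr0 eq_sym (negPf (neq_lift _ _)).
by exists e.
Qed.

(** More vectors than generators: the coefficient matrix has a nonzero row
    kernel, that is, a relation between the v_i. *)
Lemma independent_size_le V (n m : nat) (v : 'I_n -> V) (b : 'I_m -> V) :
  linearly_independent v ->
  (forall i, exists a : 'I_m -> R, v i = \sum_(j < m) a j *: b j) -> (n <= m)%N.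
Proof.
move=> vi /choice[a va]; rewrite leqNgt; apply/negP => mn.
pose M : 'M[R]_(n, m) := \matrix_(i, j) a i j.
have : kermx M != 0.
  by rewrite -mxrank_eq0 mxrank_ker subn_eq0 -ltnNge (leq_ltn_trans (rank_leq_col _)).
move=> /rowV0Pn[c /sub_kermxP cM /negP]; apply; apply/eqP/rowP => i.
rewrite mxE; apply: (vi (c ord0)).
under eq_bigr do rewrite va scaler_sumr.
rewrite exchange_big big1//= => j _.
under eq_bigr do rewrite scalerA.
rewrite -scaler_suml -[RHS](scale0r (b j)); congr (_ *: _).
by have /rowP/(_ j) := cM; rewrite !mxE => cMj; rewrite -[RHS]cMj; apply: eq_bigr => k _; rewrite mxE.
Qed.

Lemma finite_dimensional_bound V (A : set V) :
  finite_dimensional (linear_span A) ->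
  exists m, forall n (v : 'I_n -> V), (forall i, A (v i)) ->
    linearly_independent v -> (n <= m)%N.
Proof.
move=> [B /finite_seqP[s Bs] AB]; exists (size s) => n v Av vi.
apply: (independent_size_le (b := fun j : 'I_(size s) => tnth (in_tuple s) j) vi) => i.
have : linear_span B (v i).
  rewrite -AB; exists 1%N, (fun=> 1), (fun=> v i); split=> //.
  by rewrite big_ord1 scale1r.
move=> [k [a [w [Bw ->]]]].
have ws j : w j \in s by have := Bw j; rewrite Bs.
have ix j : (index (w j) s < size s)%N by rewrite index_mem.
pose ix' j := Ordinal (ix j).
exists (fun l => \sum_(j < k | ix' j == l) a j).
rewrite (partition_big ix' xpredT)//=; apply: eq_bigr => l _.
rewrite scaler_suml; apply: eq_bigr => j /eqP <-.
by rewrite (tnth_nth 0)/= nth_index.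
Qed.

(** Used to extract families of maximal size. *)
Lemma max_index (P : nat -> Prop) (m : nat) :
  P 0%N -> (forall n, P n -> (n <= m)%N) -> exists2 n, P n & ~ P n.+1.
Proof.
move=> P0 Pm; apply: contrapT => nP.
have : P m.+1; last by move/Pm; rewrite ltnn.
elim: m.+1 => // n Pn; apply: contrapT => nPn; apply: nP; exists n => //.
Qed.

Definition ocons V n (f : V) (u : 'I_n -> V) : 'I_n.+1 -> V :=
  fun i => oapp u f (unlift ord0 i).

Lemma ocons0 V n (f : V) (u : 'I_n -> V) : ocons f u ord0 = f.
Proof. by rewrite /ocons unlift_none. Qed.

Lemma oconsS V n (f : V) (u : 'I_n -> V) i : ocons f u (lift ord0 i) = u i.
Proof. by rewrite /ocons liftK. Qed.

(** Every functional of A vanishes on the common kernel of a maximal independent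
    family u of A, since it could otherwise be added to the family.  A dual
    basis e of u therefore determines it through its values on the e_j. *)
Lemma finitely_separated V (A : set (dual V)) (m : nat) :
  (forall n (u : 'I_n -> dual V), (forall i, A (u i)) ->
    linearly_independent u -> (n <= m)%N) ->
  exists n (e : 'I_n -> V), forall f g, A f -> A g ->
    (forall j, f (e j) = g (e j)) -> f = g.
Proof.
move=> Am.
have [||n [u Au ui] nmax] := @max_index (fun n => exists2 u : 'I_n -> dual V,
    (forall i, A (u i)) & linearly_independent u) m.
- by exists (fun=> 0) => [[]//|a _ []//].
- by move=> n [u Au ui]; exact: Am ui.
have [e ue] := dual_basis ui.
have vanish f v : A f -> (forall i, u i v = 0) -> f v = 0.
  move=> Af uv; apply: contrapT => fv; apply: nmax; exists (ocons f u) => [i|a].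
    by have [j ->|->] := unliftP ord0 i; rewrite ?ocons0 ?oconsS.
  rewrite big_ord_recl ocons0; under eq_bigr do rewrite oconsS.
  move=> s0; have a0 : a ord0 = 0.
    have /(congr1 (fun g : dual V => g v)) := s0.
    rewrite dual_addE dual_scaleE dual_sumE big1 => [|i _]; last by rewrite dual_scaleE uv mulr0.
    by rewrite addr0 => /eqP; rewrite mulf_eq0 => /orP[/eqP|/eqP/fv].
  move=> i; have [j ->|->//] := unliftP ord0 i.
  by apply: (ui (fun j => a (lift ord0 j))); rewrite a0 scale0r add0r in s0.
have fE f w : A f -> f w = \sum_j u j w * f (e j).
  move=> Af; have /(vanish f _ Af) : forall i, u i (w - \sum_j u j w *: e j) = 0.
    move=> i; rewrite dualB dual_sum (bigD1 i)//= big1 => [|j ji].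
      by rewrite dualZ ue eqxx addr0 mulr1 subrr.
    by rewrite dualZ ue eq_sym (negPf ji) mulr0.
  rewrite dualB dual_sum => /eqP; rewrite subr_eq0 => /eqP ->.
  by apply: eq_bigr => j _; rewrite linearZ.
exists n, e => f g Af Ag fg; apply: bopP => w.
by rewrite !fE//; apply: eq_bigr => j _; rewrite fg.
Qed.

End FiniteRankDuality.

(** * Weak-star compactness of dual balls along ultrafilters *)

Section UltraLimits.
Context {R : realType}.
Implicit Types V : normedModType R.

(** Along an ultrafilter a cluster point is a limit. *)
Lemma compact_ultra_cvg (I : Type) (U : set_system I) (T : topologicalType)
    (K : set T) (f : I -> T) : UltraFilter U -> compact K ->
  (forall i, K (f i)) -> exists2 p, K p & f @ U --> p.
Proof.
move=> UU Kc Kf.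
have fUK : (f @ U) K by apply: (@filterS _ U _ setT) filterT => i _; exact: Kf.
have [p [Kp pcl]] := Kc (f @ U) _ fUK.
exists p => // A Ap; rewrite /fmap/=.
have [//|UAc] := in_ultra_setVsetC (f @^-1` A) UU.
by have [q []] := pcl (~` A) A UAc Ap.
Qed.

Lemma bounded_ultra_cvg (I : Type) (U : set_system I) (f : I -> R) (M : R) :
  UltraFilter U -> (forall i, `|f i| <= M) -> exists l : R, f @ U --> l.
Proof.
move=> UU fM.
have [|l _ fl] := compact_ultra_cvg UU (@segment_compact R (- M) M) (f := f).
  by move=> i /=; rewrite in_itv/= -ler_norml.
by exists l.
Qed.

(** This is the form of the Banach-Alaoglu theorem used below: the pointwise
    limit of functionals of norm at most 1 is again one, so no topology on the
    dual has to be introduced. *)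
Lemma dual_ball_ultra_cvg V (I : Type) (U : set_system I) (f : I -> dual V) :
  UltraFilter U -> (forall i, `|f i| <= 1) ->
  exists2 phi : dual V, `|phi| <= 1 &
    forall v, f i v @[i --> U] --> phi v.
Proof.
move=> UU f1.
have /choice[phi phiP] : forall v, exists l : R, f i v @[i --> U] --> l.
  move=> v; apply: (@bounded_ultra_cvg _ U _ `|v|) => i.
  rewrite (le_trans (bop_norm_le (f i) v))//.
  by rewrite -[leRHS]mul1r ler_wpM2r.
have [|||phi' phi'E phi'1] := @functional_of_bound R V phi 1.
- exact: ler01.
- move=> a x y; apply: (@cvg_unique _ (@norm_hausdorff R R) (f i (a *: x + y) @[i --> U])).
    exact: phiP.
  have -> : (fun i => f i (a *: x + y) : R) = (fun i => a * f i x + f i y).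
    by apply/funext => i; rewrite dualD dualZ.
  by apply: cvgD => //; apply: cvgM => //; exact: cvg_cst.
- move=> x; apply: (cvgr_to_le (phiP x)).
  by near=> i; rewrite mul1r; exact: dual_ball_le.
by exists phi' => // v; rewrite phi'E.
Unshelve. all: by end_near. Qed.

(** Plays the role of weak-star closedness. *)
Definition ultralimit_closed V (K : set (dual V)) : Prop :=
  forall (U : set_system nat) (f : nat -> dual V) (phi : dual V),
    UltraFilter U -> (forall n, K (f n)) ->
    (forall v, f n v @[n --> U] --> phi v) -> K phi.

Definition ultralimit_continuous V (q : dual V -> R) : Prop :=
  forall (U : set_system nat) (f : nat -> dual V) (phi : dual V),
    UltraFilter U ->
    (forall v, f n v @[n --> U] --> phi v) -> q (f n) @[n --> U] --> q phi.

Lemma nat_ultrafilter : exists2 U : set_system nat, UltraFilter U & \oo `<=` U.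
Proof. by have [U [UU oU]] := ultraFilterLemma (F := \oo) _; exists U. Qed.

(** The ultralimit of a maximising sequence is a maximiser. *)
Lemma ultralimit_max V (K : set (dual V)) (q : dual V -> R) (M : R) :
  K !=set0 -> (forall f, K f -> `|f| <= 1) -> ultralimit_closed K ->
  ultralimit_continuous q -> (forall f, K f -> q f <= M) ->
  exists2 f, K f & forall g, K g -> q g <= q f.
Proof.
move=> [f0 Kf0] K1 Kc qc qM.
have qs : has_sup [set q f | f in K].
  by split; [exists (q f0), f0|exists M => _ [f Kf <-]; exact: qM].
have /choice[f fP] : forall n, exists f, K f /\ sup [set q f | f in K] - n.+1%:R^-1 < q f.
  move=> n; have n0 : 0 < n.+1%:R^-1 :> R by rewrite invr_gt0.
  by have [_ [f Kf <-] qf] := sup_adherent n0 qs; exists f.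
have [U UU oU] := nat_ultrafilter.
have [|phi phi1 fphi] := dual_ball_ultra_cvg (f := f) UU; first by move=> n; apply/K1/(fP n).1.
have Kphi : K phi by apply: Kc fphi => n; exact: (fP n).1.
exists phi => // g Kg; apply: (@le_trans _ _ (sup [set q f | f in K])).
  by apply: ub_le_sup; [case: qs|exists g].
apply/ler_addgt0Pr => e e0; rewrite -lerBlDr.
apply: (cvgr_to_ge (qc _ _ _ UU fphi)).
have : \forall n \near U, n.+1%:R^-1 < e by apply: oU; exact: near_infty_natSinv_lt (PosNum e0).
apply: filterS => n ne; apply: le_trans (ltW (fP n).2).
by rewrite lerD2l lerN2 ltW.
Qed.

End UltraLimits.

(** * Adjoints, elementary tensors and compact operators *)

Section OperatorDuality.
Context {R : realType} {X Y : normedModType R}.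
Implicit Types (A B T : bop X Y) (u : bidual X) (y : dual Y).

Lemma adjointE A y x : adjoint A y x = y (A x).
Proof. by []. Qed.

Lemma biadjointE A u y : adjoint (adjoint A) u y = u (adjoint A y).
Proof. by []. Qed.

Lemma adjoint_norm_le A y : `|adjoint A y| <= `|A| * `|y|.
Proof.
apply: opnorm_le => x x1; rewrite adjointE mulrC.
rewrite (le_trans (bop_norm_le y _))// ler_wpM2l//.
exact: (opnorm_unit_ball A).
Qed.

Lemma biadjoint_le A u y : u (adjoint A y) <= `|u| * `|A| * `|y|.
Proof.
by rewrite (le_trans (dual_le u _))// -mulrA ler_wpM2l ?adjoint_norm_le.
Qed.

Lemma adjointP (a : R) A B y :
  adjoint (a *: A + B) y = a *: adjoint A y + adjoint B y.
Proof. by apply: bopP => x; rewrite adjointE dualD dualZ. Qed.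

Lemma tensor_key u y : exists2 f : dual (bop X Y),
  (forall A, f A = u (adjoint A y)) & `|f| <= `|u| * `|y|.
Proof.
have [|||f fE f1] := @functional_of_bound R (bop X Y)
    (fun A => u (adjoint A y)) (`|u| * `|y|).
- exact: mulr_ge0.
- by move=> a A B; rewrite adjointP dualD dualZ.
- by move=> A; rewrite mulrAC biadjoint_le.
- by exists f.
Qed.

(** The elementary tensor of u and y, acting on operators. *)
Definition tensor u y : dual (bop X Y) := s2val (cid2 (tensor_key u y)).

Lemma tensorE u y A : tensor u y A = u (adjoint A y).
Proof. by rewrite /tensor; case: cid2. Qed.

Lemma tensor_norm_le u y : `|tensor u y| <= `|u| * `|y|.
Proof. by rewrite /tensor; case: cid2. Qed.

Lemma rank_one_bounded (g : dual X) (w : Y) :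
  (fun x => (g x : R) *: w) \in bounded_linear X Y.
Proof.
rewrite inE; split; first by move=> a x z; rewrite dualD dualZ scalerDl scalerA.
move=> r; exists (`|g| * r * `|w|) => x xr; rewrite normrZ ler_wpM2r//.
by rewrite (le_trans (bop_norm_le g x))// ler_wpM2l.
Qed.

Definition rank_one (g : dual X) (w : Y) : bop X Y := Bop (rank_one_bounded g w).

Lemma adjoint_rank_one g w y : adjoint (rank_one g w) y = (y w : R) *: g.
Proof. by apply: bopP => x; rewrite adjointE dualZ dual_scaleE mulrC. Qed.

Definition finite_rank n (g : 'I_n -> dual X) (w : 'I_n -> Y) : bop X Y :=
  \sum_(i < n) rank_one (g i) (w i).

Lemma finite_rankE n (g : 'I_n -> dual X) (w : 'I_n -> Y) x :
  finite_rank g w x = \sum_(i < n) (g i x : R) *: w i.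
Proof. by rewrite /finite_rank; apply: (big_morph (fun A : bop X Y => A x)). Qed.

Lemma adjoint_finite_rank n (g : 'I_n -> dual X) (w : 'I_n -> Y) y :
  adjoint (finite_rank g w) y = \sum_(i < n) (y (w i) : R) *: g i.
Proof.
apply: bopP => x; rewrite adjointE finite_rankE dual_sum dual_sumE.
by apply: eq_bigr => i _; rewrite dualZ dual_scaleE mulrC.
Qed.

(** Tested on rank-one operators, a relation between the tensors becomes, for
    each w, a relation between the u_i with coefficients a_i * y_i w. *)
Lemma tensor_independent n (u : 'I_n -> bidual X) (y : 'I_n -> dual Y) :
  linearly_independent u -> (forall i, y i <> 0) ->
  linearly_independent (fun i => tensor (u i) (y i)).
Proof.
move=> ui y0 a s0 i; apply: contrapT => ai; apply: (y0 i); apply: bopP => w.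
have /(_ i)/eqP : forall i, a i * y i w = 0.
  apply: ui; apply: bopP => g; rewrite dual_sumE.
  have /(congr1 (fun f : dual (bop X Y) => f (rank_one g w))) := s0.
  rewrite dual_sumE => s0w; rewrite -[RHS]s0w; apply: eq_bigr => j _.
  by rewrite !dual_scaleE tensorE adjoint_rank_one dualZ mulrA.
by rewrite mulf_eq0 => /orP[/eqP|/eqP].
Qed.

(** The pair norms the second adjoint of T. *)
Definition attains T u y : Prop :=
  [/\ `|u| <= 1, `|y| <= 1 & u (adjoint T y) = `|T| :> R].

Lemma tensor_support T u y : T <> 0 -> attains T u y ->
  support_functionals T (tensor u y).
Proof.
move=> T0 [u1 y1 uT]; split; last by rewrite tensorE uT.
apply/eqP; rewrite eq_le (le_trans (tensor_norm_le u y)) ?mulr_ile1//=.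
have T_gt0 : 0 < `|T| by rewrite normr_gt0; apply/eqP.
have := dual_le (tensor u y) T; rewrite tensorE uT.
by rewrite -[leLHS]mul1r ler_pM2r.
Qed.

Lemma attains_neq0 T u y : T <> 0 -> attains T u y -> y <> 0.
Proof.
move=> T0 [_ _ uT] y0; apply/T0/eqP; rewrite -normr_eq0 -uT y0.
by rewrite (linear0 (adjoint T)) dual0.
Qed.

(** This is where multi-smoothness enters: norming pairs give support
    functionals of T, and independent u_i give independent ones. *)
Lemma attaining_bound T : multi_smooth_finite_order T ->
  exists m, forall n (u : 'I_n -> bidual X),
    (forall i, exists y, attains T (u i) y) ->
    linearly_independent u -> (n <= m)%N.
Proof.
move=> [T0 /finite_dimensional_bound[m mP]]; exists m => n u /choice[y uy] ui.
apply: (mP n (fun i => tensor (u i) (y i))).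
  by move=> i; exact: tensor_support.
by apply: tensor_independent => // i; exact: attains_neq0 (uy i).
Qed.

(** A compact operator maps the unit ball into a totally bounded set. *)
Lemma compact_net T (e : R) : compact_operator T -> 0 < e ->
  exists s : seq Y, forall x, `|x| <= 1 -> exists2 w, w \in s & `|T x - w| <= e.
Proof.
move=> [K TK [Kc _]] e0; move: Kc; rewrite compact_cover.
move=> /(_ Y setT (fun w => ball w e))[||s _ Ks].
- by move=> w _; exact: ball_open.
- by move=> w _; exists w => //; exact: ballxx.
exists (finmap.enum_fset s) => x x1.
have /Ks[w /= ws] : K (T x) by apply: TK; exists x.
by rewrite -ball_normE/= distrC => /ltW we; exists w.
Qed.

(** The second adjoint of a compact operator takes values in the canonical image
    of Y, up to e.  With s an e-net of the image of the ball, T^* has norm at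
    most e on the annihilator of s, so T^** u agrees there with some f of norm
    at most e; then T^** u - f vanishes on the common kernel of finitely many
    evaluations and is a combination of them. *)
Lemma biadjoint_approx T u (e : R) : compact_operator T -> `|u| <= 1 -> 0 < e ->
  exists w : Y, `|adjoint (adjoint T) u - evaluation w| <= e.
Proof.
move=> Tc u1 e0; have [s sT] := compact_net Tc e0.
pose W : set (dual Y) := annihilator [set` s].
have uW y : W y -> adjoint (adjoint T) u y <= e * `|y|.
  move=> Wy; rewrite biadjointE (le_trans (dual_ball_le _ u1))//.
  apply: opnorm_le => x /sT[w ws Tw]; rewrite adjointE.
  have -> : y (T x) = y (T x - w) by rewrite dualB (Wy w)// subr0.
  by rewrite (le_trans (bop_norm_le y _))// mulrC ler_wpM2r.
have [f fe fW] := functional_extension (annihilator_subspace _) (ltW e0) uW.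
have [|a fa] := @kernel_lemma R (dual Y) (size s)
    (fun i => evaluation (tnth (in_tuple s) i)) (adjoint (adjoint T) u - f).
  move=> y yw; rewrite dual_addE dual_oppE fW ?subrr// => w /= ws.
  have := yw (Ordinal (etrans (index_mem w s) ws)).
  by rewrite evaluationE (tnth_nth 0)/= nth_index.
exists (\sum_(i < size s) a i *: tnth (in_tuple s) i).
suff -> : adjoint (adjoint T) u - evaluation (\sum_(i < size s) a i *: tnth (in_tuple s) i) = f by [].
apply: bopP => y; have /(congr1 (fun g : bidual Y => g y)) := fa.
rewrite !dual_addE !dual_oppE evaluationE dual_sumE dual_sum => fay.
apply/eqP; rewrite subr_eq addrC -subr_eq; apply/eqP; rewrite fay.
by apply: eq_bigr => i _; rewrite dual_scaleE evaluationE dualZ.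
Qed.

Lemma evaluation_norm_le (w : Y) : `|evaluation w| <= `|w|.
Proof.
apply: opnorm_le => y y1; rewrite evaluationE (le_trans (bop_norm_le y w))//.
by rewrite -[leRHS]mul1r ler_wpM2r.
Qed.

Lemma evaluationB (w z : Y) : evaluation (w - z) = evaluation w - evaluation z.
Proof.
by apply: bopP => y; rewrite dual_addE dual_oppE !evaluationE dualB.
Qed.

(** Duality for the distance to Z, without leaving Z for its bidual: replace
    T^** u by a nearby w in Y and use the functional that computes
    dist w Z. *)
Lemma biadjoint_near_subspace T u (Z : set Y) (r r' : R) :
  linear_subspace Z -> compact_operator T -> `|u| <= 1 ->
  (forall y, annihilator Z y -> `|y| <= 1 -> u (adjoint T y) <= r) -> r < r' ->
  exists2 z, Z z & `|adjoint (adjoint T) u - evaluation z| < r'.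
Proof.
move=> Zs Tc u1 ur rr'; pose e := (r' - r) / 4.
have e0 : 0 < e by rewrite divr_gt0// subr_gt0.
have [w uw] := biadjoint_approx Tc u1 e0.
have [y [y1 Zy yw]] := dist_functional w Zs.
have wZ : dist w Z < r + 2 * e.
  have := ur _ Zy y1.
  have : `|(evaluation w - adjoint (adjoint T) u) y| <= e.
    rewrite (le_trans (bop_norm_le _ _))// -[leRHS]mulr1 ler_pM// distrC//.
  move/(le_trans (ler_norm _)); rewrite dual_addE dual_oppE evaluationE biadjointE yw.
  by lra.
have [_ [z Zz <-] zw] := inf_lt (image_nonempty _ (ex_intro _ 0 (subspace0 Zs))) wZ.
exists z => //.
have -> : adjoint (adjoint T) u - evaluation z =
    (adjoint (adjoint T) u - evaluation w) + evaluation (w - z).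
  by rewrite evaluationB addrA subrK.
rewrite (le_lt_trans (ler_normD _ _))//.
have := evaluation_norm_le (w - z); have : 4 * e = r' - r by rewrite /e mulrC divfK.
by lra.
Qed.

End OperatorDuality.

(** * Limits of almost norming pairs *)

Section LimitPairs.
Context {R : realType} {X Y : normedModType R}.
Implicit Types (A B T : bop X Y) (u : bidual X) (y : dual Y).

(** A sequential substitute for compactness, immediate for finite rank
    operators. *)
Definition ultracompact A : Prop :=
  forall (U : set_system nat) (x : nat -> X), UltraFilter U ->
    (forall n, `|x n| <= 1) -> exists w : Y, A (x n) @[n --> U] --> w.

Lemma compact_ultracompact A : compact_operator A -> ultracompact A.
Proof.
move=> [K AK [Kc _]] U x UU x1.
have [|w _ Aw] := compact_ultra_cvg UU Kc (f := fun n => A (x n)); last by exists w.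
by move=> n; apply: AK; exists (x n) => //; exact: x1.
Qed.

Lemma finite_rank_ultracompact n (g : 'I_n -> dual X) (w : 'I_n -> Y) :
  ultracompact (finite_rank g w).
Proof.
move=> U x UU x1.
have /choice[l gl] : forall i, exists l : R, (g i (x k) : R) @[k --> U] --> l.
  move=> i; apply: (@bounded_ultra_cvg _ _ U _ `|g i|) => k.
  by rewrite (le_trans (bop_norm_le (g i) _))// -[leRHS]mulr1 ler_wpM2l.
exists (\sum_(i < n) l i *: w i).
under eq_fun do rewrite finite_rankE.
apply: cvg_big => [|i _]; [exact: add_continuous|exact: cvgZr_tmp].
Qed.

(** The pairing is jointly continuous on the weak-star compact balls because A
    turns the convergence of x_n into norm convergence in Y. *)
Lemma limit_pairing A (U : set_system nat) (x : nat -> X) (yn : nat -> dual Y) u y :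
  UltraFilter U -> ultracompact A -> (forall n, `|x n| <= 1) ->
  (forall n, `|yn n| <= 1) ->
  (forall g : dual X, (g (x n) : R) @[n --> U] --> (u g : R)) ->
  (forall w, (yn n w : R) @[n --> U] --> (y w : R)) ->
  (yn n (A (x n)) : R) @[n --> U] --> (u (adjoint A y) : R).
Proof.
move=> UU Ac x1 y1 xu yy; have [w Aw] := Ac U x UU x1.
have -> : u (adjoint A y) = y w :> R.
  apply: (@cvg_unique _ (@norm_hausdorff R R) ((y (A (x n)) : R) @[n --> U])).
    exact: (xu (adjoint A y)).
  apply/cvgrPdist_le => e e0.
  have /cvgrPdist_le/(_ (e / (`|y| + 1))) := Aw.
  rewrite divr_gt0// ?ltr_wpDl// => /(_ isT); apply: filterS => n.
  rewrite ler_pdivlMr ?ltr_wpDl// => we; rewrite -dualB.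
  apply: le_trans (bop_norm_le y _) _; apply: le_trans we.
  by rewrite mulrC ler_wpM2l// lerDl.
have -> : (fun n => yn n (A (x n)) : R) = (fun n => yn n w - yn n (w - A (x n))).
  by apply/funext => n; rewrite dualB subKr.
rewrite -[y w]subr0; apply: cvgB; first exact: yy.
apply/cvgrPdist_le => e e0; have /cvgrPdist_le/(_ _ e0) := Aw.
apply: filterS => n we; rewrite sub0r normrN.
by apply: le_trans (bop_norm_le _ _) _; rewrite -[leRHS]mul1r ler_pM.
Qed.

(** Take (x_n, y_n) norming T - e_n A up to e_n ^ 2, where e_n = 1 / (n + 1).
    As |T - e_n A| >= |T| >= y_n (T x_n), this gives y_n (A x_n) < e_n, while
    y_n (T x_n) tends to |T|. *)
Lemma orthogonal_limit_pair T A : ultracompact T -> ultracompact A ->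
  BJ_orthogonal T A ->
  exists u y, attains T u y /\ u (adjoint A y) <= 0.
Proof.
move=> Tc Ac TA.
pose e n : R := n.+1%:R^-1.
have e0 n : 0 < e n by rewrite invr_gt0.
have e1 n : e n <= 1 by rewrite invf_le1// ler1n.
have /choice[x xP] : forall n, exists x, `|x| <= 1 /\
    `|T| - e n * e n < `|(T - e n *: A) x|.
  move=> n; have ee : 0 < e n * e n by exact: mulr_gt0.
  have [_ [x x1 <-] xe] := sup_adherent ee (opnorm_has_sup (T - e n *: A)).
  exists x; split=> //; apply: le_lt_trans xe; rewrite lerD2r.
  by have := TA (- e n); rewrite scaleNr.
have /choice[y yP] : forall n, exists y : dual Y, `|y| <= 1 /\
    y ((T - e n *: A) (x n)) = `|(T - e n *: A) (x n)| :> R.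
  by move=> n; have [y] := norming_functional ((T - e n *: A) (x n)); exists y.
have x1 n : `|x n| <= 1 by case: (xP n).
have y1 n : `|y n| <= 1 by case: (yP n).
have key n : `|T| - e n * e n < y n (T (x n)) - e n * y n (A (x n)).
  have [_] := xP n; have [_ <-] := yP n.
  by rewrite -[(T - _) _]/(T (x n) - e n *: A (x n)) dualB dualZ.
have pairing_le B n : `|y n (B (x n))| <= `|B|.
  rewrite (le_trans (bop_norm_le _ _))// -[leRHS]mul1r ler_pM//.
  exact: (opnorm_unit_ball B (x1 n)).
have [U UU oU] := nat_ultrafilter.
have [|u u1 xu] := dual_ball_ultra_cvg (f := fun n => evaluation (x n)) UU.
  by move=> n; rewrite (le_trans (evaluation_norm_le _)).
have [//|y' y'1 yy] := dual_ball_ultra_cvg (f := y) UU.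
have {}xu (g : dual X) : (g (x n) : R) @[n --> U] --> (u g : R).
  by have := xu g; under eq_fun do rewrite evaluationE.
have eU d : 0 < d -> \forall n \near U, e n < d.
  by move=> d0; apply: oU; exact: near_infty_natSinv_lt (PosNum d0).
have Tlim := limit_pairing UU Tc x1 y1 xu yy.
have Alim := limit_pairing UU Ac x1 y1 xu yy.
exists u, y'; split.
  split=> //; apply/eqP; rewrite eq_le; apply/andP; split.
    apply: le_trans (biadjoint_le _ _ _) _.
    by rewrite mulrAC ler_piMl// mulr_ile1.
  apply/ler_addgt0Pr => d d0; rewrite -lerBlDr; apply: (cvgr_to_ge Tlim).
  have d'0 : 0 < d / (1 + `|A|) by rewrite divr_gt0// ltr_wpDr.
  apply: filterS (eU _ d'0) => n; rewrite ltr_pdivlMr ?ltr_wpDr// mulrDr mulr1.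
  have := key n; have := pairing_le A n; rewrite ler_norml => /andP[+ _].
  have := e0 n; have := e1 n; nra.
apply/ler_addgt0Pr => d d0; rewrite add0r; apply: (cvgr_to_le Alim).
apply: filterS (eU _ d0) => n.
have := key n; have := le_trans (ler_norm _) (pairing_le T n).
have := e0 n; nra.
Qed.

End LimitPairs.

(** * Extreme points of exposed faces *)

Section ExtremePoints.
Context {R : realType} {V : normedModType R}.

Lemma ultralimit_continuous_evaluation (v : V) :
  ultralimit_continuous (fun f : dual V => f v : R).
Proof. by move=> U f phi UU; apply. Qed.

Lemma convex_maxl (t a b c : R) : 0 < t < 1 -> a <= c -> b <= c ->
  t * a + (1 - t) * b = c -> a = c /\ b = c.
Proof. by move=> /andP[t0 t1] ac bc h; split; nra. Qed.

(** A form of Bauer's minimum principle.  Minimising h over the face f v = M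
    yields a smaller face; there, maximise the sum of the squares of the
    coordinates f (e j).  This function is strictly convex since the e j
    separate the face, so its maximiser is an extreme point. *)
Lemma exposed_face_extreme n (e : 'I_n -> V) (v h : V) (M : R) (f0 : dual V) :
  `|v| <= M -> `|f0| <= 1 -> f0 v = M :> R ->
  (forall f g : dual V, `|f| <= 1 -> `|g| <= 1 -> f v = M :> R -> g v = M :> R ->
    (forall j, f (e j) = g (e j)) -> f = g) ->
  exists f : dual V, [/\ extreme_points (unit_ball (dual V)) f,
    f v = M :> R & f h <= f0 h].
Proof.
move=> vM f01 f0v sep.
pose F : set (dual V) := [set f : dual V | `|f| <= 1 /\ f v = M :> R].
have ball_closed (U : set_system nat) (f : nat -> dual V) (phi : dual V) : UltraFilter U ->
    (forall n, `|f n| <= 1) -> (forall w, f n w @[n --> U] --> phi w) -> `|phi| <= 1.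
  move=> UU f1 fphi; have [psi psi1 fpsi] := dual_ball_ultra_cvg UU f1.
  suff -> : phi = psi by [].
  apply: bopP => w.
  by apply: (@cvg_unique _ (@norm_hausdorff R R) (f n w @[n --> U])); [exact: fphi|exact: fpsi].
have value_closed (w : V) (c : R) (U : set_system nat) (f : nat -> dual V) (phi : dual V) :
    UltraFilter U -> (forall n, f n w = c :> R) ->
    (forall w, f n w @[n --> U] --> phi w) -> phi w = c.
  move=> UU fc fphi.
  apply: (@cvg_unique _ (@norm_hausdorff R R) (f n w @[n --> U])); first exact: fphi.
  have -> : (fun n => f n w : R) = cst c by apply/funext => k; exact: fc.
  exact: cvg_cst.
have Fc : ultralimit_closed F.
  move=> U f phi UU Ff fphi; split; first by apply: ball_closed fphi => k; case: (Ff k).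
  by apply: value_closed fphi => k; case: (Ff k).
have [|||||f1 [f11 f1v] f1max] := @ultralimit_max R V F (fun f => f (- h)) `|h|.
- by exists f0.
- by move=> f [].
- exact: Fc.
- exact: ultralimit_continuous_evaluation.
- by move=> f [f1 _]; rewrite (le_trans (dual_ball_le _ f1))// normrN.
pose G : set (dual V) := [set f : dual V | F f /\ f (- h) = f1 (- h) :> R].
have Gc : ultralimit_closed G.
  move=> U f phi UU Gf fphi; split; first by apply: Fc fphi => k; case: (Gf k).
  by apply: value_closed fphi => k; case: (Gf k).
pose q (f : dual V) : R := \sum_(j < n) (f (e j) : R) ^+ 2.
have [|||||f [[f1' fv] fh] fmax] := @ultralimit_max R V G q (\sum_(j < n) `|e j| ^+ 2).
- by exists f1.
- by move=> f [[]].
- exact: Gc.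
- move=> U f phi UU fphi; apply: cvg_big => [|j _]; first exact: add_continuous.
  by rewrite expr2; under eq_fun do rewrite expr2; exact: cvgM.
- move=> f [[f1' _] _]; apply: ler_sum => j _; rewrite -[leLHS](real_normK (num_real _)).
  rewrite ler_sqr ?nnegrE//.
  by rewrite (le_trans (bop_norm_le _ _))// -[leRHS]mul1r ler_wpM2r.
exists f; split=> //; last first.
  by have := f1max f0 (conj f01 f0v); rewrite -fh !dualN lerN2.
split=> // g k t g1 k1 t01 fE.
have fEv w : f w = t * g w + (1 - t) * k w :> R.
  by rewrite fE dual_addE !dual_scaleE.
have [gv kv] : g v = M /\ k v = M.
  by apply: (@convex_maxl t); rewrite -?fEv//; apply: le_trans vM; exact: dual_ball_le.
have [gh kh] : g (- h) = f1 (- h) /\ k (- h) = f1 (- h).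
  by apply: (@convex_maxl t); rewrite -?fEv//; exact: f1max.
have gq : q g <= q f by exact: fmax.
have kq : q k <= q f by exact: fmax.
(* The defect of strict convexity of q on the segment from k to g. *)
have qE : q f = t * q g + (1 - t) * q k -
    t * (1 - t) * \sum_(j < n) (g (e j) - k (e j) : R) ^+ 2.
  rewrite /q !mulr_sumr -big_split -sumrB/=; apply: eq_bigr => j _.
  by rewrite fEv; ring.
have /andP[t0 t1] := t01.
have s0 : \sum_(j < n) (g (e j) - k (e j) : R) ^+ 2 = 0.
  apply/eqP; rewrite eq_le sumr_ge0 ?andbT => [|j _]; last exact: sqr_ge0.
  have tt : 0 < t * (1 - t) by rewrite mulr_gt0// subr_gt0.
  rewrite -(ler_pM2l tt) mulr0; move: qE gq kq.
  by set S := (X in t * (1 - t) * X); nra.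
have gk : g = k.
  apply: sep => // j; apply/eqP; rewrite -subr_eq0 -sqrf_eq0; apply/eqP.
  apply: (psumr_eq0P _ s0) => // i _; exact: sqr_ge0.
by rewrite fE -gk -scalerDl addrC subrK scale1r.
Qed.

End ExtremePoints.

(** * The extreme point nearly orthogonal to the subspace *)

Section MainArgument.
Context {R : realType} {X Y : normedModType R} (T : bop X Y) (Z : set Y).
Context (X_L1 : L1_property (bidual X)) (Zs : linear_subspace Z).
Context (Tc : compact_operator T) (Tms : multi_smooth_finite_order T).

Definition extreme_attaining : set (bidual X) :=
  [set u | extreme_points (unit_ball (bidual X)) u /\ exists y, attains T u y].

(** Choose a maximal family of extreme norm-attaining functionals that contains
    no two equal or opposite ones.  The L^1-property makes such families linearly
    independent, and multi-smoothness bounds the size of independent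
    families. *)
Lemma extreme_attaining_finite : exists n (x : 'I_n -> bidual X),
  [/\ forall i, extreme_attaining (x i), linearly_independent x &
    forall u, extreme_attaining u -> exists i, u = x i \/ u = - x i].
Proof.
have [m mP] := attaining_bound Tms.
pose sparse n (x : 'I_n -> bidual X) := (forall i, extreme_attaining (x i)) /\
  forall i j, i != j -> x i <> x j /\ x i <> - x j.
have sparse_indep n (x : 'I_n -> bidual X) : sparse n x -> linearly_independent x.
  by move=> [xe xd]; apply: X_L1 => // i; exact: (xe i).1.
have [||n [x xs] nmax] := @max_index (fun n => exists x, sparse n x) m.
- by exists (fun=> 0); split=> -[].
- move=> n [x xs]; apply: mP (sparse_indep _ _ xs) => i; exact: (xs.1 i).2.
exists n, x; split; [exact: xs.1|exact: sparse_indep|move=> u ue].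
apply: contrapT => ux; apply: nmax; exists (ocons u x); split=> [i|i j].
  by have [k ->|->] := unliftP ord0 i; rewrite ?ocons0 ?oconsS//; exact: xs.1.
have [k ->|->] := unliftP ord0 i; have [l ->|->] := unliftP ord0 j; rewrite ?ocons0 ?oconsS.
- by rewrite (inj_eq lift_inj) => kl; exact: xs.2.
- move=> _; split=> xku; apply: ux; exists k; [by left|right].
  by rewrite xku opprK.
- by move=> _; split=> uxl; apply: ux; exists l; [left|right].
- by rewrite eqxx.
Qed.

(** The first component of a norming pair may be taken extreme, without
    increasing its value at a prescribed h. *)
Lemma extreme_below u y (h : dual X) : attains T u y ->
  exists v, [/\ extreme_points (unit_ball (bidual X)) v, attains T v y & v h <= u h].
Proof.
move=> uy; have [u1 y1 uT] := uy; have [m mP] := attaining_bound Tms.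
have [n [e sep]] := @finitely_separated R (dual X) [set u | exists y, attains T u y] m mP.
have [||||v [ve vT vh]] := @exposed_face_extreme R (dual X) n e (adjoint T y) h `|T| u.
- rewrite (le_trans (adjoint_norm_le T y))// -[leRHS]mulr1 ler_wpM2l//.
- by [].
- by [].
- by move=> f g f1 g1 fT gT; apply: sep; exists y.
by exists v; split=> //; split=> //; exact: ve.1.
Qed.

(** If no extreme point works, each of the finitely many candidates x_i has
    some z_i in Z with |T^** x_i - z_i| < |T|, and the finite rank operator A
    with A^** x_i = z_i contradicts the orthogonality of T to A. *)
Lemma extreme_near_annihilator : BJ_orthogonal_set T (ops_into X Z) ->
  exists2 u : bidual X, extreme_points (unit_ball (bidual X)) u &
    forall r, r < `|T| -> exists y : dual Y,
      [/\ annihilator Z y, `|y| <= 1 & r < u (adjoint T y)].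
Proof.
move=> TZ; apply: contrapT => no_u.
have [n [x [xe xi xS]]] := extreme_attaining_finite.
have /choice[z zP] : forall i, exists z, Z z /\
    `|adjoint (adjoint T) (x i) - evaluation z| < `|T|.
  move=> i; have [xext _] := xe i.
  have [r [rT rP]] : exists r, r < `|T| /\
      forall y, annihilator Z y -> `|y| <= 1 -> x i (adjoint T y) <= r.
    apply: contrapT => nr; apply: no_u; exists (x i) => // r rT.
    apply: contrapT => ny; apply: nr; exists r; split=> // y Zy y1.
    by rewrite leNgt; apply/negP => ry; apply: ny; exists y.
  by have [z Zz xz] := biadjoint_near_subspace Zs Tc xext.1 rP rT; exists z.
have [g gP] := dual_basis xi.
pose A := finite_rank g z.
have AZ : ops_into X Z A.
  move=> w; rewrite finite_rankE.
  elim/big_ind: _ => [|a b Za Zb|i _]; first exact: subspace0.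
    exact: subspaceD.
  by apply: subspaceZ => //; case: (zP i).
have [u [y [uy uA]]] := orthogonal_limit_pair (compact_ultracompact Tc)
  (finite_rank_ultracompact g z) (TZ A AZ).
have [v [ve vy vA]] := extreme_below (adjoint A y) uy.
have [_ y1 vT] := vy.
have xA i : x i (adjoint A y) = y (z i) :> R.
  rewrite adjoint_finite_rank dual_sum (bigD1 i)//= big1 => [|j ji].
    by rewrite dualZ gP eqxx mulr1 addr0.
  by rewrite dualZ gP eq_sym (negPf ji) mulr0.
(* Norming pairs (x_i, y) thus satisfy y (z_i) > 0. *)
have close i : `|x i (adjoint T y) - y (z i)| < `|T|.
  have [_] := zP i; apply: le_lt_trans.
  have := bop_norm_le (adjoint (adjoint T) (x i) - evaluation (z i)) y.
  rewrite dual_addE dual_oppE evaluationE biadjointE => /le_trans; apply.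
  by rewrite -[leRHS]mulr1 ler_wpM2l.
have [i vx] := xS v (conj ve (ex_intro _ y vy)).
have := close i; rewrite ltr_norml => /andP[].
have := le_trans vA uA; move: vT.
case: vx => ->; rewrite ?dual_oppE xA; lra.
Qed.

End MainArgument.

(** * Distances to spaces of operators *)

Section Consequences.
Context {R : realType} {X Y : normedModType R}.

Lemma dist_orthogonal (V : normedModType R) (v : V) (W : set V) :
  linear_subspace W -> BJ_orthogonal_set v W -> dist v W = `|v|.
Proof.
move=> Ws vW; apply/eqP; rewrite eq_le; apply/andP; split.
  by rewrite -[v in leRHS]subr0; apply: ge_dist; exact: subspace0.
apply: le_dist; first by exists 0; exact: subspace0.
by move=> w /vW/(_ (-1)); rewrite scaleN1r.
Qed.

Lemma ops_into_subspace (V W : normedModType R) (Z : set W) :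
  linear_subspace Z -> linear_subspace (ops_into V Z).
Proof.
move=> Zs; apply/linear_subspaceP; split=> [x|a A B ZA ZB x].
  exact: subspace0.
by rewrite bopDE bopZE; apply: subspaceD => //; apply: subspaceZ.
Qed.

Lemma annihilator_le_dist (V : normedModType R) (f : dual V) (W : set V) (v : V) :
  linear_subspace W -> `|f| <= 1 -> annihilator W f -> f v <= dist v W.
Proof.
move=> Ws f1 fW; apply: le_dist; first by exists 0; exact: subspace0.
by move=> w Ww; rewrite -[leLHS]subr0 -(fW w Ww) -dualB dual_ball_le.
Qed.

Lemma dist_image_le (V W : normedModType R) (A : bop V W) (Z : set W) x :
  linear_subspace Z -> unit_sphere V x -> dist (A x) Z <= `|A|.
Proof.
move=> Zs x1; rewrite (@le_trans _ _ `|A x - 0|)//.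
  by apply: ge_dist; exact: subspace0.
by rewrite subr0; apply: (opnorm_unit_ball A); rewrite /unit_ball/= x1.
Qed.

Lemma dist_le_sup (V W : normedModType R) (A : bop V W) (Z : set W) x :
  linear_subspace Z -> unit_sphere V x ->
  dist (A x) Z <= sup [set dist (A x) Z | x in unit_sphere V].
Proof.
move=> Zs x1; apply: ub_le_sup; last by exists x.
by exists `|A| => _ [w w1 <-]; exact: dist_image_le.
Qed.

Lemma sup_dist_le (V W : normedModType R) (A : bop V W) (Z : set W) x :
  linear_subspace Z -> unit_sphere V x ->
  sup [set dist (A x) Z | x in unit_sphere V] <= `|A|.
Proof.
move=> Zs x1; apply: ge_sup; first by exists (dist (A x) Z), x.
by move=> _ [w w1 <-]; exact: dist_image_le.
Qed.

End Consequences.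

Theorem theorem2p6 (R : realType) (X Y : completeNormedModType R)
    (Z : set Y) (T : bop X Y) :
  L1_property (bidual X) ->
  linear_subspace Z -> closed Z ->
  compact_operator T ->
  multi_smooth_finite_order T ->
  BJ_orthogonal_set T (ops_into X Z) ->
  let Tbb : bop (bidual X) (bidual Y) := adjoint (adjoint T) in
  let Zpp : set (bidual Y) := annihilator (annihilator Z) in
  [/\ dist T (ops_into X Z) = sup [set dist (T x) Z | x in unit_sphere X],
      exists x0 : bidual X,
        [/\ norm_attainment Tbb x0,
            extreme_points (unit_ball (bidual X)) x0 &
            BJ_orthogonal_set (Tbb x0) Zpp],
      BJ_orthogonal_set Tbb (ops_into (bidual X) Zpp) &
      exists x0 : bidual X,
        [/\ norm_attainment Tbb x0 /\ extreme_points (unit_ball (bidual X)) x0,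
            dist Tbb (ops_into (bidual X) Zpp) =
              sup [set dist (Tbb x) Zpp | x in unit_sphere (bidual X)],
            sup [set dist (Tbb x) Zpp | x in unit_sphere (bidual X)] =
              dist (Tbb x0) Zpp &
            dist (Tbb x0) Zpp = dist T (ops_into X Z)]].
Proof.
move=> X_L1 Zs _ Tc Tms TZ Tbb Zpp.
have [u ue uT] := extreme_near_annihilator X_L1 Zs Tc Tms TZ.
have T0 : T <> 0 by case: Tms.
have T_gt0 : 0 < `|T| by rewrite normr_gt0; apply/eqP.
have u1 : `|u| <= 1 by case: ue.
have Zpps : linear_subspace Zpp by exact: annihilator_subspace.
have le_T (c : R) : (forall y, annihilator Z y -> `|y| <= 1 -> u (adjoint T y) <= c) ->
    `|T| <= c.
  move=> yc; rewrite leNgt; apply/negP => /uT[y [Zy y1]].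
  by rewrite ltNge yc.
have Tbb_le : `|Tbb| <= `|T|.
  apply: opnorm_le => w w1; apply: opnorm_le => y y1.
  rewrite biadjointE (le_trans (bop_norm_le w _))//.
  rewrite (le_trans (ler_wpM2l _ (adjoint_norm_le T y)))//.
  by rewrite mulrCA ler_piMr// mulr_ile1.
have Tu_le : `|Tbb u| <= `|Tbb| by exact: (opnorm_unit_ball Tbb).
(* Functionals in the annihilator of Z bound distances to Zpp from below. *)
have bidual_le (f : bidual Y) (g : bidual Y) y : Zpp g -> annihilator Z y ->
    `|y| <= 1 -> f y <= `|f + g|.
  move=> Zg Zy y1; have := dual_le (f + g) y; rewrite dual_addE (Zg y Zy) addr0.
  by move=> /le_trans; apply; rewrite ler_piMr.
have T_le_u (g : bidual Y) : Zpp g -> `|T| <= `|Tbb u + g|.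
  by move=> Zg; apply: le_T => y Zy y1; exact: (bidual_le (Tbb u)).
have T_le_Tu : `|T| <= `|Tbb u|.
  by rewrite -[Tbb u]addr0; apply: T_le_u; exact: subspace0.
have TbbE : `|Tbb| = `|T|.
  by apply/eqP; rewrite eq_le Tbb_le (le_trans T_le_Tu).
have TuE : `|Tbb u| = `|T|.
  by apply/eqP; rewrite eq_le T_le_Tu -{1}TbbE Tu_le.
have u_unit : unit_sphere (bidual X) u.
  apply/eqP; rewrite eq_le u1 /=.
  have := bop_norm_le Tbb u; rewrite TuE TbbE.
  by rewrite -[leLHS]mulr1 ler_pM2l.
have u_att : norm_attainment Tbb u by split; rewrite // TuE TbbE.
have u_orth : BJ_orthogonal_set (Tbb u) Zpp.
  by move=> g Zg l; rewrite TuE; exact: T_le_u (subspaceZ l Zpps Zg).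
have Tbb_orth : BJ_orthogonal_set Tbb (ops_into (bidual X) Zpp).
  move=> A ZA l; rewrite TbbE.
  apply: le_trans (opnorm_unit_ball (Tbb + l *: A) u1).
  exact: T_le_u (subspaceZ l Zpps (ZA u)).
have distT : dist T (ops_into X Z) = `|T|.
  by apply: dist_orthogonal => //; exact: ops_into_subspace.
have distTbb : dist Tbb (ops_into (bidual X) Zpp) = `|T|.
  by rewrite -TbbE; apply: dist_orthogonal => //; exact: ops_into_subspace.
have distTu : dist (Tbb u) Zpp = `|T| by rewrite -TuE; exact: dist_orthogonal.
have supTbb : sup [set dist (Tbb x) Zpp | x in unit_sphere (bidual X)] = `|T|.
  apply/eqP; rewrite eq_le -{1}TbbE (sup_dist_le _ Zpps u_unit)/=.
  by rewrite -distTu dist_le_sup.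
split=> //; [|by exists u|by exists u; rewrite distTbb supTbb distTu distT].
rewrite distT; set D := sup _.
have [x0 x01] : exists x0, unit_sphere X x0.
  have [x Tx] : exists x, T x <> 0.
    apply: contrapT => nx; apply: T0; apply: bopP => x.
    by apply: contrapT => Tx; apply: nx; exists x.
  have x_neq0 : `|x| != 0.
    by apply/eqP => /normr0_eq0 x0; apply: Tx; rewrite x0 linear0.
  by exists (`|x|^-1 *: x); rewrite /unit_sphere/= normrZ normfV normr_id mulVf.
have D_le : D <= `|T| by exact: sup_dist_le x01.
have D0 : 0 <= D by exact: le_trans (dist_ge0 _ _) (dist_le_sup T Zs x01).
apply/eqP; rewrite eq_le D_le andbT; apply: le_T => y Zy y1.
apply: le_trans (dual_ball_le _ u1) _.
have yT x : `|x| <= 1 -> y (T x) <= D.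
  move=> x1; have [->|x_neq0] := eqVneq x 0; first by rewrite linear0 dual0.
  have nx : 0 < `|x| by rewrite normr_gt0.
  have w1 : unit_sphere X (`|x|^-1 *: x).
    by rewrite /unit_sphere/= normrZ normfV normr_id mulVf// gt_eqF.
  have := annihilator_le_dist (T (`|x|^-1 *: x)) Zs y1 Zy.
  move=> /le_trans/(_ (dist_le_sup T Zs w1)).
  by rewrite linearZ/= dualZ ler_pdivrMl// => /le_trans; apply; rewrite ler_piMl.
apply: opnorm_le => x x1; rewrite adjointE ler_norml yT// andbT lerNl -dualN.
by rewrite -linearN yT// normrN.
Qed.
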